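(* Let $\Gamma=(m_{i,j})_{i,j\in I}$ be a Coxeter matrix, $J\subseteq I$, and $\tilde J$ an admissible partition of $\Gamma_J$, of type $\tilde\Gamma=(|r_\alpha r_\beta|)_{\alpha,\beta\in\tilde J}$. Let $\varphi:B^+_{\tilde\Gamma}\to B^+_\Gamma$ be the morphism with $\varphi(\mathbf s_\alpha)=\mathbf r_\alpha$ for all $\alpha\in\tilde J$, let $\tilde B^+$ be the submonoid of $B^+_\Gamma$ generated by $\{\mathbf r_\alpha\mid\alpha\in\tilde J\}$, and let $\tilde{\mathbf W}=\{\mathbf w\mid w\in\tilde W\}\subseteq\mathbf W_\Gamma$, where $\tilde W$ is the subgroup of $W_\Gamma$ generated by $\{r_\alpha\mid\alpha\in\tilde J\}$. Then $$\varphi(\mathbf W_{\tilde\Gamma})=\tilde B^+\cap\mathbf W_\Gamma=\tilde{\mathbf W}.$$ Moreover, if $\tilde\Gamma$ (or equivalently $\Gamma_J$) is spherical, then $\varphi(\mathbf r_{\tilde J})=\mathbf r_J$.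
   Context: A Coxeter matrix over an arbitrary (possibly infinite) set $I$ is a family $\Gamma=(m_{i,j})_{i,j\in I}$ with $m_{i,j}=m_{j,i}\in\mathbb N_{\geq 1}\cup\{\infty\}$ and $m_{i,j}=1\iff i=j$. For $n\in\mathbb N$, $\prod_n(x,y)$ is the alternating product $xyxy\cdots$ with $n$ factors starting with $x$. $W_\Gamma$ is the Coxeter group generated by $s_i$ ($i\in I$) with relations $s_i^2=1$ and $\prod_{m_{i,j}}(s_i,s_j)=\prod_{m_{i,j}}(s_j,s_i)$ if $m_{i,j}\ne\infty$. $B^+_\Gamma$ is the monoid presented by generators $\mathbf s_i$ ($i\in I$) and relations $\prod_{m_{i,j}}(\mathbf s_i,\mathbf s_j)=\prod_{m_{i,j}}(\mathbf s_j,\mathbf s_i)$ for $m_{i,j}\neq\infty$. $\ell$ denotes word length on $W_\Gamma$ with respect to $\{s_i\}$. For $w\in W_\Gamma$, $\mathbf w\in B^+_\Gamma$ is the element represented by any reduced word of $w$ (well defined by Tits' theorem); such elements are called simple and $\mathbf W_\Gamma=\{\mathbf w\mid w\in W_\Gamma\}$ (similarly $\mathbf W_{\tilde\Gamma}\subseteq B^+_{\tilde\Gamma}$). For $J\subseteq I$, $\Gamma_J=(m_{i,j})_{i,j\in J}$ and $W_J=\langle s_j\mid j\in J\rangle$. $J$ (or $\Gamma_J$) is spherical if $W_J$ is finite; then $r_J$ is the unique element of maximal length in $W_J$ and $\mathbf r_J\in B^+_\Gamma$ is the corresponding simple element. When $\tilde\Gamma$ is spherical, $\mathbf r_{\tilde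 J}\in B^+_{\tilde\Gamma}$ is the simple element corresponding to the longest element of $W_{\tilde\Gamma}$. A partition $\tilde J$ of $J$ (into non-empty parts) is spherical if every $\alpha\in\tilde J$ is spherical; its type is the Coxeter matrix $\tilde\Gamma=(|r_\alpha r_\beta|)_{\alpha,\beta\in\tilde J}$ of orders of the products $r_\alpha r_\beta$ in $W_\Gamma$. For $w\in W_J$, put $J^{\pm}(w)=\{j\in J\mid \ell(ws_j)=\ell(w)\pm1\}$. The partition $\tilde J$ of $\Gamma_J$ is admissible if it is spherical and for all $(w,\alpha)\in\tilde W\times\tilde J$ either $\alpha\subseteq J^+(w)$ or $\alpha\subseteq J^-(w)$. When $\tilde J$ is admissible, the assignment $\mathbf s_\alpha\mapsto\mathbf r_\alpha$ does extend to a monoid morphism $\varphi:B^+_{\tilde\Gamma}\to B^+_\Gamma$. *)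

(* Defs.v *)
From HB Require Import structures.
From mathcomp Require Import all_boot.
From mathcomp Require Import boolp classical_sets cardinality.

Set Implicit Arguments.
Unset Strict Implicit.
Unset Printing Implicit Defensive.

Local Open Scope classical_set_scope.
Local Open Scope quotient_scope.
Local Open Scope group_scope.

Section PresentedMonoid.
Variables (X : choiceType) (R : seq X -> seq X -> Prop).

(* The congruence on the free monoid [seq X] generated by [R]. *)
Inductive pres_cong : seq X -> seq X -> Prop :=
| pres_step p u v q : R u v -> pres_cong (p ++ u ++ q) (p ++ v ++ q)
| pres_refl u : pres_cong u u
| pres_sym u v : pres_cong u v -> pres_cong v u
| pres_trans v u w : pres_cong u v -> pres_cong v w -> pres_cong u w.

Definition pres_congb (u v : seq X) : bool := `[< pres_cong u v >].

Lemma pres_congb_refl : reflexive pres_congb.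
Proof. by move=> u; apply/asboolP; exact: pres_refl. Qed.

Lemma pres_congb_sym : symmetric pres_congb.
Proof. by move=> u v; apply/asboolP/asboolP; exact: pres_sym. Qed.

Lemma pres_congb_trans : transitive pres_congb.
Proof.
by move=> v u w /asboolP uv /asboolP vw; apply/asboolP; exact: pres_trans vw.
Qed.

Canonical pres_equiv :=
  EquivRel pres_congb pres_congb_refl pres_congb_sym pres_congb_trans.

Definition pres_monoid := {eq_quot pres_equiv}.

HB.instance Definition _ := Choice.on pres_monoid.
HB.instance Definition _ := EqQuotient.on pres_monoid.

Lemma pres_piP (u v : seq X) :
  \pi_pres_monoid u = \pi_pres_monoid v <-> pres_cong u v.
Proof.
split=> [/eqP | uv]; first by rewrite piE => /asboolP.
by apply/eqP; rewrite piE; apply/asboolP.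
Qed.

Lemma pres_cong_cat p u v q :
  pres_cong u v -> pres_cong (p ++ u ++ q) (p ++ v ++ q).
Proof.
move=> uv; elim: uv => {u v} [p' u v q' Ruv | u | u v _ | v u w _ uv _ vw].
- rewrite !catA -!(catA (p ++ p')) -!catA 2!(catA p p').
  exact: (pres_step (p ++ p') (q' ++ q)).
- exact: pres_refl.
- exact: pres_sym.
- exact: pres_trans vw.
Qed.

Definition pres_mul (a b : pres_monoid) : pres_monoid :=
  \pi_pres_monoid (repr a ++ repr b).

Lemma pres_mul_pi u v :
  pres_mul (\pi_pres_monoid u) (\pi_pres_monoid v) = \pi_pres_monoid (u ++ v).
Proof.
have reprP w : pres_cong (repr (\pi_pres_monoid w)) w.
  by apply/pres_piP; rewrite reprK.
apply/pres_piP; apply: (@pres_trans (u ++ repr (\pi_pres_monoid v))).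
  exact: (pres_cong_cat [::] _ (reprP u)).
by have := pres_cong_cat u [::] (reprP v); rewrite !cats0.
Qed.

Lemma pres_mulA : associative pres_mul.
Proof.
elim/quotW=> u; elim/quotW=> v; elim/quotW=> w.
by rewrite (pres_mul_pi v w) (pres_mul_pi u v) !pres_mul_pi catA.
Qed.

Lemma pres_mul1 : left_id (\pi_pres_monoid [::]) pres_mul.
Proof. by elim/quotW=> u; rewrite pres_mul_pi. Qed.

Lemma pres_mulr1 : right_id (\pi_pres_monoid [::]) pres_mul.
Proof. by elim/quotW=> u; rewrite pres_mul_pi cats0. Qed.

HB.instance Definition _ :=
  isMonoid.Build pres_monoid pres_mulA pres_mul1 pres_mulr1.

Definition pres_gen (x : X) : pres_monoid := \pi_pres_monoid [:: x].

Lemma pres_piE (u : seq X) : \pi_pres_monoid u = \prod_(x <- u) pres_gen x.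
Proof.
elim: u => [|x u IHu]; first by rewrite big_nil.
by rewrite big_cons -IHu -[RHS]/(pres_mul _ _) pres_mul_pi.
Qed.

End PresentedMonoid.

Section PresentedGroup.
Variables (X : choiceType) (R : seq (X * bool) -> seq (X * bool) -> Prop).

(* In group words, [(x, true)] stands for [x] and [(x, false)] for [x^-1]. *)
Inductive pres_group_rel : seq (X * bool) -> seq (X * bool) -> Prop :=
| pres_cancel x b : pres_group_rel [:: (x, b); (x, ~~ b)] [::]
| pres_relator u v : R u v -> pres_group_rel u v.

Definition pres_group := pres_monoid pres_group_rel.

HB.instance Definition _ := Monoid.on pres_group.

Definition inv_word (u : seq (X * bool)) : seq (X * bool) :=
  rev [seq (x.1, ~~ x.2) | x <- u].

Lemma inv_wordK : involutive inv_word.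
Proof.
move=> u; rewrite /inv_word map_rev revK -map_comp -[RHS]map_id.
by apply: eq_map => -[x b] /=; rewrite negbK.
Qed.

Lemma mul_inv_word (u : seq (X * bool)) :
  pres_cong pres_group_rel (u ++ inv_word u) [::].
Proof.
elim: u => [|[x b] u IHu]; first exact: pres_refl.
rewrite /inv_word /= rev_cons -cats1.
apply: (@pres_trans _ _ [:: (x, b); (x, ~~ b)]).
  by have := pres_cong_cat [:: (x, b)] [:: (x, ~~ b)] IHu; rewrite -!catA.
exact: (pres_step [::] [::] (pres_cancel x b)).
Qed.

Definition pres_inv (a : pres_group) : pres_group :=
  \pi_(pres_monoid pres_group_rel) (inv_word (repr a)).

Lemma pres_mulgV : right_inverse 1 pres_inv (@mul pres_group).
Proof.
move=> a; rewrite -[a in LHS]reprK -[LHS]/(pres_mul _ _) pres_mul_pi.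
by apply/pres_piP; rewrite reprK; exact: mul_inv_word.
Qed.

Lemma pres_mulVg : left_inverse 1 pres_inv (@mul pres_group).
Proof.
move=> a; rewrite -[a in LHS]reprK -[LHS]/(pres_mul _ _) pres_mul_pi.
apply/pres_piP; rewrite reprK -[X in _ ++ X]inv_wordK; exact: mul_inv_word.
Qed.

HB.instance Definition _ := hasInv.Build pres_group pres_inv.
HB.instance Definition _ :=
  Monoid_isGroup.Build pres_group pres_mulVg pres_mulgV.

Definition pres_group_gen (x : X) : pres_group :=
  pres_gen pres_group_rel (x, true).

End PresentedGroup.

Definition generated_monoid (G : monoidType) (A : set G) : set G :=
  smallest (fun H : set G => monoid_closed [in H]) A.

Definition generated_group (G : groupType) (A : set G) : set G :=
  smallest (fun H : set G => group_closed [in H]) A.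

(* The order of [x], where [None] stands for infinity. *)
Definition gorder (G : groupType) (x : G) : option nat :=
  if pselect (exists n, (0 < n)%N && (x ^+ n == 1)) is left xn
  then Some (ex_minn xn) else None.

(* The word [x y x y ...] with [n] letters. *)
Fixpoint alt_word (X : Type) (n : nat) (x y : X) : seq X :=
  if n is n'.+1 then x :: alt_word n' y x else [::].

(* In Coxeter matrices, [None] stands for infinity. The groups and monoids
   below are defined by their presentations for an arbitrary family [m], so
   that the type of a partition needs no proof of being a Coxeter matrix. *)
Definition coxeter_matrix (I : Type) (m : I -> I -> option nat) : Prop :=
  [/\ forall i j, m i j = m j i,
      forall i j, m i j <> Some 0 &
      forall i j, m i j = Some 1%N <-> i = j].

Section Coxeter.
Variables (I : choiceType) (m : I -> I -> option nat).

Inductive coxeter_rel : seq (I * bool) -> seq (I * bool) -> Prop :=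
| coxeter_square i : coxeter_rel [:: (i, true); (i, true)] [::]
| coxeter_braid i j n : m i j = Some n ->
    coxeter_rel (alt_word n (i, true) (j, true))
                (alt_word n (j, true) (i, true)).

Definition coxeter_group := pres_group coxeter_rel.
HB.instance Definition _ := Group.on coxeter_group.

Definition cox_gen (i : I) : coxeter_group := pres_group_gen coxeter_rel i.

Inductive artin_rel : seq I -> seq I -> Prop :=
| artin_braid i j n : m i j = Some n ->
    artin_rel (alt_word n i j) (alt_word n j i).

Definition artin_monoid := pres_monoid artin_rel.
HB.instance Definition _ := Monoid.on artin_monoid.

Definition artin_gen (i : I) : artin_monoid := pres_gen artin_rel i.

Lemma cox_gen2 i : cox_gen i * cox_gen i = 1.
Proof.
rewrite -[LHS]/(pres_mul _ _) pres_mul_pi; apply/pres_piP.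
exact: (pres_step [::] [::] (pres_relator (coxeter_square i))).
Qed.

Lemma cox_word_ex (w : coxeter_group) :
  exists s : seq I, \prod_(i <- s) cox_gen i = w.
Proof.
suff [s ws] : exists s : seq I, \prod_(i <- s) cox_gen i =
    \pi_(pres_monoid (pres_group_rel coxeter_rel)) (repr w).
  by exists s; rewrite ws reprK.
rewrite pres_piE; elim: (repr w) => [|[i b] u [s IHs]].
  by exists [::]; rewrite !big_nil.
exists (i :: s); rewrite !big_cons; congr (_ * _); last exact: IHs.
case: b => //; apply: (@mulIg coxeter_group (cox_gen i)).
rewrite cox_gen2 -[RHS]/(pres_mul _ _) pres_mul_pi; apply/esym/pres_piP.
exact: (pres_step [::] [::] (pres_cancel coxeter_rel i false)).
Qed.

Lemma cox_length_ex (w : coxeter_group) :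
  exists n, `[< exists s : seq I, \prod_(i <- s) cox_gen i = w /\ size s = n >].
Proof.
by have [s ws] := cox_word_ex w; exists (size s); apply/asboolP; exists s.
Qed.

Definition cox_length (w : coxeter_group) : nat := ex_minn (cox_length_ex w).

Definition reduced (s : seq I) (w : coxeter_group) : bool :=
  (\prod_(i <- s) cox_gen i == w) && (size s == cox_length w).

Lemma reduced_ex (w : coxeter_group) : exists s : seq I, reduced s w.
Proof.
rewrite /reduced /cox_length; case: ex_minnP => n /asboolP[s [<- <-]] _.
by exists s; rewrite !eqxx.
Qed.

(* Any reduced word gives the same element, by Tits' theorem. *)
Definition simple_elt (w : coxeter_group) : artin_monoid :=
  \prod_(i <- xchoose (reduced_ex w)) artin_gen i.

Definition simple_elts : set artin_monoid := range simple_elt.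

Definition parabolic (J : set I) : set coxeter_group :=
  generated_group (cox_gen @` J).

Definition spherical (J : set I) : Prop := finite_set (parabolic J).

(* Meaningful for spherical [J] only; the maximum is then unique. *)
Definition longest (J : set I) : coxeter_group :=
  xget 1 [set w | parabolic J w /\
                  forall v, parabolic J v -> (cox_length v <= cox_length w)%N].

Definition ascents (J : set I) (w : coxeter_group) : set I :=
  [set j | J j /\ cox_length (w * cox_gen j) = (cox_length w).+1].

Definition descents (J : set I) (w : coxeter_group) : set I :=
  [set j | J j /\ (cox_length (w * cox_gen j)).+1 = cox_length w].

Definition folded_group (P : set (set I)) : set coxeter_group :=
  generated_group (longest @` P).

Definition folded_monoid (P : set (set I)) : set artin_monoid :=
  generated_monoid ((fun a => simple_elt (longest a)) @` P).

Definition spherical_partition (J : set I) (P : set (set I)) : Prop :=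
  partition P id J /\ forall a, P a -> spherical a.

Definition admissible (J : set I) (P : set (set I)) : Prop :=
  spherical_partition J P /\
  forall w a, folded_group P w -> P a ->
    a `<=` ascents J w \/ a `<=` descents J w.

(* The Coxeter matrix is indexed by the subtype of [set I] defined by [P]. *)
Definition partition_type (P : set (set I)) (a b : P) : option nat :=
  gorder (longest (val a) * longest (val b)).

End Coxeter.

Arguments cox_gen {I} m i.
Arguments artin_gen {I} m i.
Arguments simple_elt {I m} w.
Arguments simple_elts {I} m _.
Arguments parabolic {I} m J _.
Arguments longest {I} m J.
Arguments folded_group {I} m P _.
Arguments folded_monoid {I} m P _.
Arguments spherical_partition {I} m J P.
Arguments admissible {I} m J P.
Arguments partition_type {I} m P a b.

(* Main.v *)
Require Import Defs.
From HB Require Import structures.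
From mathcomp Require Import all_boot.
From mathcomp Require Import boolp classical_sets cardinality.
From mathcomp Require Import all_algebra algC cyclotomic zify ring.

(* Call a word in the longest elements r_a additive if the length of its product
   in W is the sum of the lengths of its letters. By admissibility, multiplying
   an element of the folded group by r_a either adds or subtracts the length of
   r_a, so that the proof of Tits' theorem applies: two additive words for the
   same element are braid-equivalent for the folded type. Hence reduced words
   of the folded Coxeter group are additive, which makes the map to W injective
   and sends simple elements to simple elements. Tits' theorem itself is the
   case of the partition into singletons; it needs that the product of s_i and
   s_j has order exactly m i j, which comes from the geometric representation. *)

Set Implicit Arguments.
Unset Strict Implicit.
Unset Printing Implicit Defensive.

Local Open Scope classical_set_scope.
Local Open Scope group_scope.

(** * Actions of Coxeter groups and the exchange condition *)

Section AltWord.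
Variable X : Type.
Implicit Types x y : X.

Lemma altS n x y : alt_word n.+1 x y = x :: alt_word n y x.
Proof. by []. Qed.

Lemma size_alt n x y : size (alt_word n x y) = n.
Proof. by elim: n x y => //= n IHn x y; rewrite IHn. Qed.

Lemma map_alt (Y : Type) (f : X -> Y) n x y :
  map f (alt_word n x y) = alt_word n (f x) (f y).
Proof. by elim: n x y => //= n IHn x y; rewrite IHn. Qed.

Lemma alt_cat p q x y : alt_word (p + q) x y =
  alt_word p x y ++ (if odd p then alt_word q y x else alt_word q x y).
Proof. by elim: p x y => //= p IHp x y; rewrite IHp; case: (odd p). Qed.

Lemma alt_rcons n x y :
  alt_word n.+1 x y = rcons (alt_word n x y) (if odd n then y else x).
Proof. by rewrite -addn1 alt_cat; case: (odd n); rewrite cats1. Qed.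

Lemma rev_alt n x y :
  rev (alt_word n x y) = if odd n then alt_word n x y else alt_word n y x.
Proof.
elim: n => // n IHn; rewrite [in LHS]alt_rcons rev_rcons IHn /=.
by case: (odd n).
Qed.

(** For involutions the second factor is the inverse of the other braid word, so this passes between
    [(x y)^n = 1] and the braid relation of length [n]. *)
Lemma alt_double n x y :
  alt_word (n + n) x y = alt_word n x y ++ rev (alt_word n y x).
Proof. by rewrite alt_cat rev_alt; case: (odd n). Qed.

End AltWord.

Section Actions.
Variables (I X : Type) (act : I -> X -> X).
Hypothesis actK : forall i, involutive (act i).

Lemma foldr_revK u : cancel (fun x => foldr act x (rev u)) (fun x => foldr act x
  u).
Proof.
by elim: u => //= i u IHu x; rewrite rev_cons foldr_rcons IHu actK.
Qed.

Lemma foldr_braid n i j :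
  (forall x, foldr act x (alt_word (n + n) i j) = x) ->
  forall x, foldr act x (alt_word n i j) = foldr act x (alt_word n j i).
Proof.
move=> actn x; rewrite -[RHS]actn alt_double foldr_cat; congr foldr.
by rewrite -[X in foldr _ _ (rev X)]revK revK -[X in foldr _ (foldr _ _ X)
  _]revK
  foldr_revK.
Qed.

End Actions.

Lemma gorder_some (G : groupType) (x : G) n : (0 < n)%N -> x ^+ n = 1 ->
  (forall k, (0 < k < n)%N -> x ^+ k <> 1) -> gorder x = Some n.
Proof.
move=> n0 xn xk; rewrite /gorder; case: pselect => [ex|]; last first.
  by case; exists n; rewrite n0 xn eqxx.
case: ex_minnP => k /andP[k0 /eqP xk1] kmin; congr Some.
have kn : (k <= n)%N by apply: kmin; rewrite n0 xn eqxx.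
by move: kn; rewrite leq_eqVlt => /predU1P[//|kn]; case: (xk k); rewrite // k0.
Qed.

Lemma gorder_none (G : groupType) (x : G) :
  (forall k, (0 < k)%N -> x ^+ k <> 1) -> gorder x = None.
Proof.
move=> xk; rewrite /gorder; case: pselect => // ex; exfalso.
by have [k /andP[k0 /eqP]] := ex; exact: xk.
Qed.

Lemma gorder_someP (G : groupType) (x : G) n : gorder x = Some n ->
  (0 < n)%N /\ x ^+ n = 1.
Proof.
rewrite /gorder; case: pselect => // ex; case: ex_minnP => k /andP[k0 /eqP xk1]
  _.
by case=> <-.
Qed.

Section CoxeterWords.
Variables (I : choiceType) (m : I -> I -> option nat).
Local Notation W := (coxeter_group m).
Local Notation len w := (cox_length w%g).
Local Notation pr u := (\prod_(i <- u) cox_gen m i).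
Implicit Types (w v : W) (u s t : seq I).

Lemma cox_pi u : pr u = \pi_(pres_monoid (pres_group_rel (coxeter_rel m)))%qT
                          [seq (i, true) | i <- u].
Proof. by rewrite pres_piE big_map. Qed.

(** The universal property of the Coxeter group, for words. It serves for the sign, for reflections,
    for the geometric representation and for left multiplications. *)
Lemma cox_act (X : Type) (act : I -> X -> X) :
  (forall i, involutive (act i)) ->
  (forall i j n, m i j = Some n -> forall x,
     foldr act x (alt_word n i j) = foldr act x (alt_word n j i)) ->
  forall s t, pr s = pr t -> forall x, foldr act x s = foldr act x t.
Proof.
move=> actK actB s t; rewrite !cox_pi => /pres_piP st x.
(* A letter and its formal inverse act alike, which respects cancellation because each [act i] is an
   involution. *)
pose A := foldr (fun p : I * bool => act p.1).
have AE u y : A y [seq (i, true) | i <- u] = foldr act y u.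
  by elim: u => //= i u ->.
rewrite -!AE; move: st; move: (map _ s) (map _ t) => {}s {}t st.
elim: st x => {s t} [p u v q Ruv x|//|u v _ IH x|v u w _ IH1 _ IH2 x]; last 2
  first.
- by rewrite IH.
- by rewrite IH1.
rewrite /A !foldr_cat -!/A; congr foldr; move: (A x q) => {}x.
case: Ruv => [i b|{}u {}v [i|i j n mij]]; try exact: actK.
by have := actB _ _ _ mij x; rewrite -!AE !map_alt.
Qed.

Lemma pr_rcons u i : pr (rcons u i) = pr u * cox_gen m i.
Proof. by rewrite -cats1 big_cat big_cons big_nil /= mulg1. Qed.

Lemma genK i w : w * cox_gen m i * cox_gen m i = w.
Proof. by rewrite -mulgA cox_gen2 mulg1. Qed.

Lemma genV i : (cox_gen m i)^-1 = cox_gen m i.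
Proof. by apply: mulg1_eq; exact: cox_gen2. Qed.

Lemma pr_rev u : pr (rev u) = (pr u)^-1.
Proof.
elim: u => [|i u IHu]; first by rewrite !big_nil invg1.
by rewrite rev_cons pr_rcons IHu big_cons invgM genV.
Qed.

Lemma pr_alt n i j :
  pr (alt_word (n + n) i j) = (cox_gen m i * cox_gen m j) ^+ n.
Proof.
elim: n => [|n IHn]; first by rewrite big_nil.
by rewrite addSn addnS !altS !big_cons IHn expgS mulgA.
Qed.

Lemma len_le u : (len (pr u) <= size u)%N.
Proof.
rewrite /cox_length; case: ex_minnP => n _; apply; apply/asboolP.
by exists u.
Qed.

Lemma reducedP w : exists2 u, pr u = w & size u = len w.
Proof. by have [u /andP[/eqP uw /eqP us]] := reduced_ex w; exists u. Qed.

Lemma len1 : len (1 : W) = 0.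
Proof. by have := len_le [::]; rewrite big_nil leqn0 => /eqP. Qed.

Lemma len_eq0 w : len w = 0 -> w = 1.
Proof.
by have [u <- <-] := reducedP w; move/size0nil => ->; rewrite big_nil.
Qed.

Lemma lenM w v : (len (w * v) <= len w + len v)%N.
Proof.
have [s <- <-] := reducedP w; have [t <- <-] := reducedP v.
by have := len_le (s ++ t); rewrite big_cat size_cat.
Qed.

Lemma lenV w : len w^-1 = len w.
Proof.
have le v : (len v^-1 <= len v)%N.
  by have [s <- <-] := reducedP v; rewrite -pr_rev -(size_rev s); apply: len_le.
by apply/eqP; rewrite eqn_leq le -{1}[w]invgK le.
Qed.

(** The sign character: each letter flips a boolean, and the two sides of a braid relation have
    equally many letters. *)
Lemma odd_len u : odd (len (pr u)) = odd (size u).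
Proof.
have [s su <-] := reducedP (pr u).
have H t b : foldr (fun (_ : I) => negb) b t = odd (size t) (+) b.
  by elim: t => //= _ t ->; rewrite addNb.
have := @cox_act bool (fun _ => negb) _ _ s u su false.
rewrite !H !addbF; apply=> [i|i j n _ b]; first exact: negbK.
by rewrite !H !size_alt.
Qed.

Lemma len_gen w i : len (w * cox_gen m i) = (len w).+1 \/
  (len (w * cox_gen m i)).+1 = len w.
Proof.
have [u uw us] := reducedP w.
have le v : (len (v * cox_gen m i) <= (len v).+1)%N.
  by apply: (leq_trans (lenM _ _)); have := len_le [:: i]; rewrite big_seq1 /=;
    lia.
have := le w; have := le (w * cox_gen m i); rewrite genK.
have := odd_len (rcons u i); rewrite pr_rcons uw size_rcons /= us.
by move: (len _) (len w) => a b; lia.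
Qed.

(* W acts on W x bool, the second component recording the parity of the number
   of occurrences of a reflection among those attached to a word. *)
Definition refl_act (i : I) (p : W * bool) : W * bool :=
  (cox_gen m i * p.1 * cox_gen m i, p.2 (+) (p.1 == cox_gen m i)).

Lemma refl_actK i : involutive (refl_act i).
Proof.
case=> t e; rewrite /refl_act /= !mulgA genK cox_gen2 mul1g; congr pair.
rewrite -addbA -[RHS]addbF; congr addb.
suff -> : (cox_gen m i * t * cox_gen m i == cox_gen m i) = (t == cox_gen m i).
  by rewrite addbb.
apply/eqP/eqP => [E|->]; last by rewrite genK.
have : cox_gen m i * (cox_gen m i * t * cox_gen m i) * cox_gen m i =
  cox_gen m i * cox_gen m i * cox_gen m i by rewrite E.
by rewrite !mulgA !genK cox_gen2 mul1g.
Qed.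

Lemma refl_act_fold u (t : W) e : foldr refl_act (t, e) u =
  (pr u * t * (pr u)^-1, (foldr refl_act (t, false) u).2 (+) e).
Proof.
elim: u t e => [|i u IHu] t e; first by rewrite !big_nil invg1 mul1g mulg1.
rewrite /= IHu [in RHS]IHu /refl_act /= big_cons invgM genV !mulgA; congr pair.
by rewrite addbF addbAC.
Qed.

(** The reflections attached to the alternating word of length [2n] are the [s_j d^k] with [k < 2n].
    If [d^n = 1], this list repeats after [n] terms and all parities vanish. *)
Lemma refl_act_alt n i j (t : W) (d := cox_gen m i * cox_gen m j) :
  (foldr refl_act (t, false) (alt_word (n + n) i j)).2 =
  \big[addb/false]_(k < n + n) (t == cox_gen m j * d ^+ k).
Proof.
have dV : d^-1 = cox_gen m j * cox_gen m i by rewrite invgM !genV.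
have swap k : d ^- k * cox_gen m j = cox_gen m j * d ^+ k.
  elim: k => [|k IHk]; first by rewrite !expg0 invg1 mul1g mulg1.
  by rewrite [in LHS]expgSr invgM -mulgA IHk dV expgS !mulgA.
have conj k x : (d ^+ k * t * d ^- k == x) = (t == d ^- k * x * d ^+ k).
  by apply/eqP/eqP => [<-|->]; rewrite -!mulgA ?mulVg ?mulKg ?mulgV ?mulVKg
    mulg1.
elim: n => [|n IHn]; first by rewrite big_ord0.
rewrite addSn addnS !big_ord_recr -IHn !altS /= refl_act_fold pr_alt -/d.
rewrite /refl_act /= addbF conj; congr (_ (+) _ (+) _).
  by rewrite swap -mulgA -expgnDr.
have -> : (cox_gen m j * (d ^+ n * t * d ^- n) * cox_gen m j == cox_gen m i) =
   (d ^+ n * t * d ^- n == cox_gen m j * d).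
  move: (d ^+ n * t * d ^- n) => x; rewrite /d.
  apply/eqP/eqP => [<-|->]; first by rewrite !mulgA genK cox_gen2 mul1g.
  by rewrite !mulgA genK cox_gen2 mul1g.
by rewrite conj mulgA swap -mulgA -expgS -mulgA -expgnDr addnS.
Qed.

Lemma gen_braid i j n : m i j = Some n ->
  pr (alt_word n i j) = pr (alt_word n j i).
Proof.
move=> mij; rewrite !cox_pi !map_alt; apply/pres_piP.
have := @pres_step _ (pres_group_rel (coxeter_rel m)) [::] _ _ [::]
  (pres_relator (coxeter_braid mij)).
by rewrite !cats0.
Qed.

Lemma gen_order i j n : m i j = Some n ->
  (cox_gen m i * cox_gen m j) ^+ n = 1.
Proof.
move=> mij; rewrite -pr_alt alt_double big_cat pr_rev /=.
by rewrite (gen_braid mij) mulgV.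
Qed.

Lemma refl_act_word s t : pr s = pr t ->
  forall x, foldr refl_act x s = foldr refl_act x t.
Proof.
apply: cox_act; first exact: refl_actK.
move=> i j n /gen_order dn; apply: foldr_braid; first exact: refl_actK.
case=> t0 e; rewrite refl_act_fold refl_act_alt pr_alt dn mul1g invg1 mulg1.
congr pair; rewrite big_split_ord /=.
rewrite [X in _ (+) X (+) _](eq_bigr (fun k : 'I_n =>
  t0 == cox_gen m j * (cox_gen m i * cox_gen m j) ^+ k)) => [|k _].
  by rewrite addbb.
by rewrite expgnDr dn mul1g.
Qed.

(** An odd count is positive: for some factorization [u = a ++ i :: b] the conjugate of [s_j] by the
    product of [b] is [s_i], so [s_j] moves past [b] and cancels that letter. *)
Lemma odd_refl_exchange u j : (foldr refl_act (cox_gen m j, false) u).2 ->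
  exists a i b, u = a ++ i :: b /\ pr u * cox_gen m j = pr (a ++ b).
Proof.
elim: u => //= i u IHu; rewrite refl_act_fold addbF /=.
case E: (foldr _ _ u).2.
  move=> _; have [a [k [b [-> Eb]]]] := IHu E.
  by exists (i :: a), k, b; rewrite /= !big_cons -mulgA Eb.
move=> /= /eqP ji.
exists [::], i, u; rewrite cat0s big_cons; split=> //.
apply: (@mulIg _ (pr u)^-1).
by rewrite mulgV -!mulgA (mulgA (pr u)) ji cox_gen2.
Qed.

(** If the count of [s_j] along [u] were even, it would be odd along a reduced word of [u s_j], as
    appending [j] flips it. Deleting a letter there would make [u] shorter than [u s_j]. *)
Lemma exchange u j :
  (len (pr u * cox_gen m j) < len (pr u))%N ->
  exists a i b, u = a ++ i :: b /\ pr u * cox_gen m j = pr (a ++ b).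
Proof.
move=> lt; apply: odd_refl_exchange; apply/negPn/negP => even.
have [t tE ts] := reducedP (pr u * cox_gen m j).
have Eu : pr u = pr (rcons t j) by rewrite pr_rcons tE genK.
move: even; rewrite (refl_act_word Eu) foldr_rcons /refl_act /= eqxx cox_gen2
  mul1g.
rewrite refl_act_fold /= addbT negbK => /odd_refl_exchange[a [i [b [tab]]]].
rewrite tE genK => Eab; have := len_le (a ++ b).
by rewrite -Eab; move: lt; rewrite -ts tab !size_cat /=; lia.
Qed.

End CoxeterWords.

(** * Orders of products of two generators *)

(* The geometric representation is used in its contragredient form on functions
   I -> algC, with entries -(z + z^-1) off the diagonal, z a primitive 2n-th
   root of unity if m i j = n (and z = 2 if m i j is infinite). The linear forms
   x i + z * x j and x i + z^-1 * x j are eigenvectors of s_i s_j with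
   eigenvalues z^2 and z^-2. *)
Section Geometric.
Local Open Scope ring_scope.
Import GRing.Theory Num.Theory.

Definition prim_root (n : nat) : algC := xget 1 [set z : algC |
  n.-primitive_root z].

Lemma prim_rootP n : (0 < n)%N -> n.-primitive_root (prim_root n).
Proof.
move=> n0; have [z zn] := C_prim_root_exists n0.
exact: (@xgetI _ 1 [set z : algC | n.-primitive_root z] z).
Qed.

Variables (I : choiceType) (m : I -> I -> option nat).
Hypothesis cm : coxeter_matrix m.

Definition geom_root i j : algC :=
  if m i j is Some n then prim_root n.*2 else 2.

Definition geom_coef i j : algC :=
  if i == j then 2 else - (geom_root i j + (geom_root i j)^-1).

Definition geom_act (i : I) (x : I -> algC) : I -> algC :=
  fun k => x k - x i * geom_coef i k.

Lemma geom_actK i : involutive (geom_act i).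
Proof.
move=> x; apply: funext => k; rewrite /geom_act /geom_coef eqxx; ring.
Qed.

Lemma geom_root_sym i j : geom_root i j = geom_root j i.
Proof. by case: cm => mC _ _; rewrite /geom_root mC. Qed.

Lemma geom_root_neq0 i j : geom_root i j != 0.
Proof.
case: cm => mC m0 _; rewrite /geom_root; case E: (m i j) => [[|n]|].
- by case: (m0 i j).
- apply/eqP => z0; have /prim_expr_order := prim_rootP (isT : (0 < n.+1.*2)%N).
  by rewrite z0 expr0n => /eqP; rewrite eq_sym oner_eq0.
- by rewrite pnatr_eq0.
Qed.

Lemma geom_root_expr i j k : geom_root i j ^+ k.*2 = 1 <->
  ((if m i j is Some n then n %| k else k == 0) : bool)%N.
Proof.
case: cm => mC m0 _; rewrite /geom_root; case E: (m i j) => [[|n]|].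
- by case: (m0 i j).
- have P := prim_rootP (isT : (0 < n.+1.*2)%N).
  rewrite -[(_ %| _)%N](@dvdn_pmul2l 2) // !mul2n (prim_order_dvd P).
  by split=> [->|/eqP].
split=> [/eqP|/eqP-> //]; case: k => // k.
rewrite -natrX pnatr_eq1 -(expn0 2) eqn_exp2l //; lia.
Qed.

Section Pair.
Variables (i j : I).
Hypothesis ij : i != j.
Local Notation z := (geom_root i j).
Implicit Type x : I -> algC.

Let D x := geom_act i (geom_act j x).

Lemma geom_word n x : foldr geom_act x (alt_word (n + n) i j) = iter n D x.
Proof. by elim: n => // n IHn; rewrite addSn addnS !altS /= IHn. Qed.

Let form (u : algC) x := x i + u * x j.

Lemma form_eig u x : u = z \/ u = z^-1 -> form u (D x) = u ^+ 2 * form u x.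
Proof.
have z0 := geom_root_neq0 i j.
have zji : geom_root j i = z by rewrite geom_root_sym.
rewrite /form /D /geom_act /geom_coef !eqxx (negPf ij) eq_sym (negPf ij) zji.
by case=> ->; field.
Qed.

Lemma form_eig_iter u x n : u = z \/ u = z^-1 ->
  form u (iter n D x) = u ^+ n.*2 * form u x.
Proof.
move=> Hu; elim: n => [|n IHn] /=; first by rewrite mul1r.
by rewrite form_eig // IHn doubleS !exprS; ring.
Qed.

Lemma geom_faithful n : (forall x, iter n D x = x) -> z ^+ n.*2 = 1.
Proof.
(* On the indicator of [i] the form takes the value 1, so the eigenvalue itself is read off. *)
move=> Dn; pose x k : algC := (k == i)%:R.
have /eqP := form_eig_iter x n (or_introl erefl).
rewrite Dn /form /x eqxx [j == i]eq_sym (negPf ij) mulr0 addr0 mulr1.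
by move/eqP.
Qed.

(** [D] moves each coordinate by a combination of the two eigenforms. As their eigenvalues differ
    from 1, adding multiples of the forms turns the coordinate into a [D]-invariant. After [n] steps
    the forms return to their values, hence so does the coordinate. *)
Lemma geom_id n : z ^+ n.*2 = 1 -> z ^+ 2 != 1 -> forall x, iter n D x = x.
Proof.
move=> zn z2 x; have z0 := geom_root_neq0 i j.
have zVn : z^-1 ^+ n.*2 = 1 by rewrite exprVn zn invr1.
have d0 : z - z^-1 != 0.
  apply: contra z2; rewrite subr_eq0 => /eqP E.
  by rewrite expr2 {1}E mulVf.
have E1 : 1 - z ^+ 2 != 0 by rewrite subr_eq0 eq_sym.
have E2 : 1 - z^-1 ^+ 2 != 0.
  by rewrite subr_eq0 eq_sym exprVn invr_eq1.
have z21 : z ^+ 2 - 1 != 0 by rewrite subr_eq0.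
apply: funext => k.
have [p [q Dk]] : exists p q, forall y, D y k = y k + p * form z y + q * form
  z^-1 y.
  (* [P] and [Q] are the coefficients of [y i] and [y j] in [D y k - y k]; the witnesses solve
     [p + q = P] and [p z + q z^-1 = Q]. *)
  pose P := - geom_coef i k; pose Q := - geom_coef j k + geom_coef j i *
    geom_coef i k.
  exists ((- P * z^-1 + Q) / (z - z^-1)), ((P * z - Q) / (z - z^-1)) => y.
  rewrite /form /D /geom_act /P /Q; field.
  by rewrite z0 -expr2 z21.
pose e := p / (1 - z ^+ 2); pose f := q / (1 - z^-1 ^+ 2).
have inv y : D y k + e * form z (D y) + f * form z^-1 (D y) =
   y k + e * form z y + f * form z^-1 y.
  rewrite Dk !form_eig; [|by right|by left].
  have -> : p = e * (1 - z ^+ 2) by rewrite divfK.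
  have -> : q = f * (1 - z^-1 ^+ 2) by rewrite divfK.
  ring.
have invn y r : iter r D y k + e * form z (iter r D y) + f * form z^-1 (iter r D
  y) =
   y k + e * form z y + f * form z^-1 y.
  by elim: r => // r IHr; rewrite -IHr /= inv.
have := invn x n; rewrite !form_eig_iter; [|by right|by left].
by rewrite zn zVn !mul1r => /addIr /addIr.
Qed.

End Pair.

(** The relations bound the order from above. From below, a trivial [n]-th power acts trivially in
    the representation, so [z^(2n) = 1]. *)
Lemma gorder_gen i j :
  gorder (cox_gen m i * cox_gen m j)%g = m i j.
Proof.
case: cm => mC m0 m1; have [->|ij] := eqVneq i j.
  have -> : m j j = Some 1%N by apply/m1.
  apply: gorder_some; rewrite ?cox_gen2 //; by case.
have act s t : (\prod_(i <- s) cox_gen m i = \prod_(i <- t) cox_gen m i)%g ->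
    forall x, foldr geom_act x s = foldr geom_act x t.
  apply: cox_act; first exact: geom_actK.
  move=> a b n mab; have [->//|ab] := eqVneq a b.
  apply: foldr_braid; first exact: geom_actK.
  move=> x; rewrite geom_word; apply: geom_id => //.
    by apply/geom_root_expr; rewrite mab.
  apply/eqP => /(geom_root_expr a b 1); rewrite mab dvdn1 => /eqP n1.
  by move/eqP: ab; apply; apply/m1; rewrite mab n1.
have pow n : ((cox_gen m i * cox_gen m j) ^+ n = 1)%g ->
    ((if m i j is Some n' then n' %| n else n == 0) : bool)%N.
  rewrite -pr_alt => E; apply/(geom_root_expr i j n); apply: (geom_faithful ij)
    => x.
  by rewrite -geom_word; apply: (act _ [::]); rewrite E big_nil.
case E: (m i j) pow => [n|] pow.
  have n0 : (0 < n)%N by case: n E {pow} => // /(m0 i j).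
  apply: gorder_some => //; first exact: gen_order.
  by move=> k /andP[k0 kn] /pow; rewrite gtnNdvd.
by apply: gorder_none => k k0 /pow /eqP k0'; rewrite k0' in k0.
Qed.

End Geometric.

(** * Parabolic subgroups and longest elements *)

Lemma gen_groupP (G : groupType) (A : set G) :
  group_closed [in generated_group A].
Proof.
split; first by apply/mem_set => B [[/set_mem]].
move=> u v /set_mem uA /set_mem vA; apply/mem_set => B BA.
by case: (BA) => -[_ BF] _; apply/set_mem/BF; apply/mem_set; [exact: uA|exact:
  vA].
Qed.

Lemma gen_groupV (G : groupType) (A : set G) x :
  generated_group A x -> generated_group A x^-1.
Proof.
by move/mem_set/(group_closedV (gen_groupP A))/set_mem.
Qed.

Lemma gen_groupM (G : groupType) (A : set G) x y :
  generated_group A x -> generated_group A y -> generated_group A (x * y).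
Proof.
move=> /mem_set xA /mem_set yA.
by have /set_mem := group_closedM (gen_groupP A) xA yA.
Qed.

Lemma finite_argmax (T : choiceType) (A : set T) (f : T -> nat) x0 :
  finite_set A -> A x0 -> exists2 x, A x & forall y, A y -> (f y <= f x)%N.
Proof.
move=> /finite_seqP[s As] Ax0.
have ex : exists n, `[< exists2 x, A x & f x = n >].
  by exists (f x0); apply/asboolP; exists x0.
have bnd n : `[< exists2 x, A x & f x = n >] -> (n <= \sum_(y <- s) f y)%N.
  move=> /asboolP[x]; rewrite As /= => xs <-.
  by rewrite (big_rem x) //= leq_addr.
case: (ex_maxnP ex bnd) => n /asboolP[x Ax <-] xmax; exists x => // y Ay.
by apply: xmax; apply/asboolP; exists y.
Qed.

Lemma cat_eq_split (T : Type) (s t a b : seq T) i : s ++ t = a ++ i :: b ->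
  (exists c, s = a ++ i :: c /\ b = c ++ t) \/
  (exists c, a = s ++ c /\ t = c ++ i :: b).
Proof.
elim: s a => [|k s IHs] [|l a] /=; first by right; exists [::].
- by move=> ->; right; exists (l :: a).
- by case=> -> <-; left; exists s.
case=> -> /IHs[] [c [-> ->]]; first by left; exists c.
by right; exists c.
Qed.

Section Parabolic.
Variables (I : choiceType) (m : I -> I -> option nat).
Local Notation W := (coxeter_group m).
Local Notation len w := (cox_length w%g).
Local Notation pr u := (\prod_(i <- u) cox_gen m i).
Local Notation gen := (cox_gen m).
Implicit Types (w v x y : W) (u s t : seq I) (K : set I).

Definition ascending K w := forall k, K k -> (len w < len (w * gen k))%N.
Definition descending K w := forall k, K k -> (len (w * gen k) < len w)%N.

Lemma asc_or_desc w k :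
  (len w < len (w * gen k))%N \/ (len (w * gen k) < len w)%N.
Proof. by case: (len_gen w k) => E; [left; rewrite E|right; rewrite -E]. Qed.

Lemma len_asc w k : (len w < len (w * gen k))%N -> len (w * gen k) = (len w).+1.
Proof. by case: (len_gen w k) => // <-; rewrite ltnNge leqnSn. Qed.

Lemma reduced_cat s t : size (s ++ t) = len (pr (s ++ t)) ->
  size s = len (pr s) /\ size t = len (pr t).
Proof.
rewrite size_cat big_cat /= => E; have := lenM (pr s) (pr t).
rewrite -E; have := len_le m s; have := len_le m t.
by move: (len _) (len _) => p q; lia.
Qed.

Lemma reduced_rcons s k : size (rcons s k) = len (pr (rcons s k)) ->
  size s = len (pr s) /\ (len (pr s) < len (pr s * gen k))%N.
Proof.
move=> E; have E' := E; rewrite -cats1 in E'; have [sr _] := reduced_cat E'.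
by split=> //; rewrite -pr_rcons -E size_rcons sr.
Qed.

Lemma parabolicP K w :
  parabolic m K w <-> exists2 u, all (mem K) u & pr u = w.
Proof.
split=> [|[u uK <-]]; last first.
  elim: u uK => [|k u IHu] /=.
    by rewrite big_nil => _; have [/set_mem] := gen_groupP [set gen i | i in K].
  move=> /andP[/set_mem kK /IHu uK]; rewrite big_cons; apply: gen_groupM => //.
  by apply: sub_gen_smallest; exists k.
move: w; apply: smallest_sub => [|_ [k kK <-]]; last first.
  by exists [:: k]; rewrite ?big_seq1 //= andbT; apply: mem_set.
split; first by apply/mem_set; exists [::]; rewrite ?big_nil.
move=> _ _ /set_mem[s sK <-] /set_mem[t tK <-]; apply/mem_set.
by exists (s ++ rev t); rewrite ?all_cat ?all_rev ?sK // big_cat pr_rev.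
Qed.

Lemma parabolicM K w v :
  parabolic m K w -> parabolic m K v -> parabolic m K (w * v).
Proof. exact: gen_groupM. Qed.

Lemma parabolicV K w : parabolic m K w -> parabolic m K w^-1.
Proof. exact: gen_groupV. Qed.

Lemma parabolic_gen K k : K k -> parabolic m K (gen k).
Proof. by move=> kK; apply: sub_gen_smallest; exists k. Qed.

Lemma parabolic1 K : parabolic m K 1.
Proof. by apply/parabolicP; exists [::]; rewrite ?big_nil. Qed.

Lemma sub_parabolic K L w : K `<=` L -> parabolic m K w -> parabolic m L w.
Proof.
move=> KL /parabolicP[u uK uw]; apply/parabolicP; exists u => //.
by apply: sub_all uK => k /set_mem kK; apply/mem_set/KL.
Qed.

(** Exchange only deletes letters, so a word in [K] can be shortened to a reduced one without
    leaving [K]. *)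
Lemma parabolic_reduced K w : parabolic m K w ->
  exists u, [/\ all (mem K) u, pr u = w & size u = len w].
Proof.
move=> /parabolicP[u uK <-]; elim/last_ind: u uK => [|u k IHu].
  by exists [::]; rewrite big_nil len1.
rewrite all_rcons => /andP[kK /IHu[s [sK su ss]]].
case: (len_gen (pr u) k) => E.
  by exists (rcons s k); rewrite all_rcons kK !pr_rcons su size_rcons ss E.
have [|a [i [b [sab Eab]]]] := @exchange _ m s k; first by rewrite su -E.
exists (a ++ b); split; last 2 first.
- by rewrite -Eab su pr_rcons.
- by apply: succn_inj; rewrite pr_rcons E -ss sab !size_cat addnS.
by move: sK; rewrite sab !all_cat /= => /and3P[-> _ ->].
Qed.

Lemma parabolic_desc K w : parabolic m K w -> w <> 1 ->
  exists2 k, K k & (len (w * gen k) < len w)%N.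
Proof.
move=> /parabolic_reduced[u [uK uw us]] w1; move: uK uw us.
case/lastP: u => [_|u k]; first by rewrite big_nil => /esym.
rewrite all_rcons => /andP[/set_mem kK _] <- us; exists k => //.
rewrite pr_rcons genK -pr_rcons -us size_rcons ltnS; exact: len_le.
Qed.

(** The letter deleted by exchange lies either in a reduced word of [x] or in one of [v]. *)
Lemma exchange_mul x v k : (len (x * v * gen k) < len (x * v))%N ->
  (exists2 y, (len y < len x)%N & x * v * gen k = y * v) \/
  (len (v * gen k) < len v)%N.
Proof.
have [s <- ss] := reducedP x; have [t <- ts] := reducedP v.
rewrite -big_cat /= => /exchange[a [i [b [st E]]]].
have [|] := cat_eq_split st => -[c [E1 E2]].
  left; exists (pr (a ++ c)).
    by rewrite -ss E1; apply: (leq_ltn_trans (len_le m _)); rewrite !size_cat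
      /=; lia.
  by rewrite E E2 catA big_cat.
right; have Et : pr t * gen k = pr (c ++ b).
  apply: (@mulgI _ (pr s)); rewrite mulgA.
  by move: E; rewrite big_cat /= => ->; rewrite E1 -catA big_cat.
rewrite Et -ts E2; apply: (leq_ltn_trans (len_le m _)); rewrite !size_cat /=;
  lia.
Qed.

(** Take [x] of minimal length in the coset of [w]. Appending a reduced word in [K] letter by
    letter, a drop in length would delete a letter of [x], giving a shorter element of the coset, or
    contradict reducedness of the word. *)
Lemma coset_min K w : exists x v, [/\ w = x * v, parabolic m K v &
  forall y, parabolic m K y -> len (x * y) = (len x + len y)%N].
Proof.
have ex : exists n, `[< exists2 v, parabolic m K v & len (w * v) = n >].
  by exists (len (w * 1)); apply/asboolP; exists 1 => //; exact: parabolic1.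
case: (ex_minnP ex) => n /asboolP[v vK <-] xmin.
exists (w * v), v^-1; split; [by rewrite mulgK|exact: parabolicV|].
set x := w * v in xmin *.
have {}xmin y : parabolic m K y -> (len x <= len (x * y))%N.
  move=> yK; apply: xmin; apply/asboolP; exists (v * y); rewrite ?mulgA //.
  exact: parabolicM.
move=> y /parabolic_reduced[u [uK <- us]]; rewrite -us.
elim/last_ind: u uK us => [|u k IHu]; first by rewrite big_nil mulg1 addn0.
rewrite all_rcons => /andP[/set_mem kK uK] /reduced_rcons[us asc].
rewrite pr_rcons mulgA size_rcons addnS -IHu //.
case: (asc_or_desc (x * pr u) k) => [/len_asc //|/exchange_mul[[z zx E]|]].
  have uP : parabolic m K (pr u) by apply/parabolicP; exists u.
  have := xmin _ (parabolicM (parabolicM uP (parabolic_gen kK)) (parabolicV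
    uP)).
  by rewrite !mulgA E mulgK leqNgt zx.
by move=> desc; have := ltn_trans asc desc; rewrite ltnn.
Qed.

(** An ascending element is its own minimal coset representative: a nontrivial factor [y] in
    [w = x * y] would have a descent in [K], and so would [w]. *)
Lemma asc_len K w v : ascending K w -> parabolic m K v ->
  len (w * v) = (len w + len v)%N.
Proof.
have [x [y [wE yK xmin]]] := coset_min K w.
have [y1 _ vK|y1] := eqVneq y 1; first by rewrite wE y1 mulg1 xmin.
have [k kK ky] := parabolic_desc yK (elimN eqP y1).
move=> /(_ k kK); rewrite wE -mulgA xmin // xmin ?ltn_add2l.
  by move=> ky'; have := ltn_trans ky ky'; rewrite ltnn.
by apply: parabolicM => //; exact: parabolic_gen.
Qed.

(** By exchange, every reduced word in [K] is a suffix of some reduced word of [w]; this is applied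
    to a word of [v^-1]. *)
Lemma desc_len K w v : descending K w -> parabolic m K v ->
  (len (w * v) + len v)%N = len w.
Proof.
move=> wK vK; suff H u : all (mem K) u -> size u = len (pr u) ->
    exists2 y, w = y * pr u & len w = (len y + size u)%N.
  have [u [uK uv us]] := parabolic_reduced (parabolicV vK).
  have [||y wE wl] := H u => //; first by rewrite uv.
  by rewrite -(lenV v) wl us wE uv mulgVK.
elim/last_ind: u => [|u k IHu]; first by exists w; rewrite ?big_nil ?mulg1
  ?addn0.
rewrite all_rcons => /andP[/set_mem kK uK] /reduced_rcons[us asc].
have [y wE wl] := IHu uK us; have := wK k kK; rewrite {1 2}wE.
case/exchange_mul => [[z zy E]|desc]; last first.
  by have := ltn_trans asc desc; rewrite ltnn.
have wz : w = z * (pr u * gen k) by rewrite mulgA -E wE genK.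
exists z; first by rewrite pr_rcons.
rewrite size_rcons.
have := lenM z (pr u * gen k); rewrite -wz wl (len_asc asc) -us.
by move: zy; move: (len _) (len _) => p q; lia.
Qed.

(** Maximality comes from [desc_len]; for another maximal [v] the same formula leaves length 0 for
    [w * v^-1]. *)
Lemma desc_longest K w : parabolic m K w -> descending K w -> longest m K = w.
Proof.
move=> wK wd; apply: xget_unique => [|v [vK vmax]].
  by split=> // v vK; rewrite -(desc_len wd vK) leq_addl.
have := desc_len wd (parabolicV vK); rewrite lenV => E.
have := vmax _ wK; rewrite -E -{2}[len v]add0n leq_add2r leqn0 => /eqP/len_eq0.
by move/divg1_eq.
Qed.

Lemma longestP K : spherical m K ->
  parabolic m K (longest m K) /\ descending K (longest m K).
Proof.
move=> fK; have [x xK xmax] := finite_argmax (@cox_length _ m) fK (@parabolic1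
  K).
have [rK rmax] : parabolic m K (longest m K) /\
    forall v, parabolic m K v -> (len v <= len (longest m K))%N.
  by rewrite /longest; case: xgetP => [//|/(_ x)[]].
split=> // k kK; case: (asc_or_desc (longest m K) k) => //.
by rewrite ltnNge rmax //; apply: parabolicM => //; exact: parabolic_gen.
Qed.

Lemma longest_sqr K : spherical m K -> longest m K * longest m K = 1.
Proof.
case/longestP=> rK rd; apply: len_eq0.
by have := desc_len rd rK; move: (len _) (len _) => p q; lia.
Qed.

(** Multiplying [w] by a reduced word in [K] lowers the length at each letter, so exchange writes
    the result as a subword of one fixed reduced word of [w]. There are finitely many subwords. *)
Lemma desc_spherical K w : parabolic m K w -> descending K w -> spherical m K.
Proof.
move=> wK wd; have [s sw _] := reducedP w.
pose f (b : (size s).-tuple bool) := w^-1 * pr (mask b s).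
apply: (@sub_finite_set _ _ (f @` setT)); last by apply: finite_image; exact:
  finite_finset.
suff H u : all (mem K) u -> size u = len (pr u) ->
    exists2 t, subseq t s & pr t = w * pr u.
  move=> v /parabolic_reduced[u [uK <- us]].
  have [_ /subseqP[b bs ->] E] := H u uK us.
  by exists (Tuple (introT eqP bs)); rewrite // /f /= E mulKg.
elim/last_ind: u => [|u k IHu]; first by exists s; rewrite ?big_nil ?mulg1.
rewrite all_rcons => /andP[kK uK] red.
have [us asc] := reduced_rcons red.
have [t ts tE] := IHu uK us.
have uP t' : all (mem K) t' -> parabolic m K (pr t').
  by move=> tK; apply/parabolicP; exists t'.
have := desc_len wd (uP _ uK).
have := desc_len wd (uP (rcons u k) _); rewrite all_rcons kK uK => /(_ isT).
rewrite -red -us size_rcons => E1 E2.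
have [|a [i [b [tab Eab]]]] := @exchange _ m t k.
  by rewrite tE -mulgA -pr_rcons; move: E1 E2; move: (len _) (len _) (len _) =>
    p q r; lia.
exists (a ++ b); last by rewrite -Eab tE pr_rcons mulgA.
apply: subseq_trans ts; rewrite tab; apply: cat_subseq => //; exact:
  subseq_cons.
Qed.

End Parabolic.

(** * Additive words in a folded group *)

Section ArtinWords.
Variables (I : choiceType) (m : I -> I -> option nat).

Lemma artin_cong_size s t : pres_cong (artin_rel m) s t -> size s = size t.
Proof.
elim=> // [p u v q [i j n _]|u v w _ -> _ ->//].
by rewrite !size_cat !size_alt.
Qed.

Lemma artin_cong_prod s t : pres_cong (artin_rel m) s t ->
  \prod_(i <- s) cox_gen m i = \prod_(i <- t) cox_gen m i.
Proof.
elim=> // [p u v q [i j n mij]|u v w _ -> _ ->//].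
by rewrite !big_cat /= (gen_braid mij).
Qed.

Lemma artin_cong_cat s s' t t' : pres_cong (artin_rel m) s s' ->
  pres_cong (artin_rel m) t t' -> pres_cong (artin_rel m) (s ++ t) (s' ++ t').
Proof.
move=> ss tt; apply: (@pres_trans _ _ (s' ++ t)).
  by have := pres_cong_cat [::] t ss.
by have := pres_cong_cat s' [::] tt; rewrite !cats0.
Qed.

Lemma artin_cong_rcons s t i : pres_cong (artin_rel m) s t ->
  pres_cong (artin_rel m) (rcons s i) (rcons t i).
Proof.
by move=> st; rewrite -!cats1; apply: artin_cong_cat st (pres_refl _ _).
Qed.

Lemma artin_cong_rev_alt i j n : m i j = Some n ->
  pres_cong (artin_rel m) (rev (alt_word n i j)) (rev (alt_word n j i)).
Proof.
move=> mij; have := pres_step [::] [::] (artin_braid mij).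
by rewrite !cats0 !rev_alt; case: (odd n) => // /pres_sym.
Qed.

End ArtinWords.

(* For additive words of the same element with last letters a and b, the element
   is x d with x of minimal length in its coset of <r a, r b>; peeling letters
   off d from the right writes it as an alternating word ending with a, and also
   as one ending with b. The case S i = [set i] is Tits' theorem. *)
Section Folding.
Variables (I : choiceType) (m : I -> I -> option nat).
Local Notation W := (coxeter_group m).
Local Notation len w := (cox_length w%g).
Variables (A : choiceType) (S : A -> set I) (r : A -> W).
Local Notation rp u := (\prod_(a <- u) r a).
Local Notation wt u := (\sum_(a <- u) cox_length (r a)).
Hypothesis rS : forall a, parabolic m (S a) (r a).
Hypothesis rr : forall a, r a * r a = 1.
Hypothesis r0 : forall a, (0 < len (r a))%N.
Hypothesis adm : forall u a, ascending (S a) (rp u) \/ descending (S a) (rp u).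

Definition fold_type (a b : A) := gorder (r a * r b).
Definition additive (u : seq A) := len (rp u) = wt u.

Implicit Types (u v s t : seq A) (a b c : A) (w x : W).

Lemma rp_rcons u a : rp (rcons u a) = rp u * r a.
Proof. by rewrite -cats1 big_cat big_seq1. Qed.

Lemma wt_rcons u a : wt (rcons u a) = (wt u + len (r a))%N.
Proof. by rewrite -cats1 big_cat big_seq1. Qed.

Lemma rK w a : w * r a * r a = w.
Proof. by rewrite -mulgA rr mulg1. Qed.

Lemma rp_rev u : rp (rev u) = (rp u)^-1.
Proof.
elim: u => [|a u IHu]; first by rewrite !big_nil invg1.
by rewrite rev_cons rp_rcons IHu big_cons invgM (mulg1_eq (rr a)).
Qed.

Lemma wt_rev u : wt (rev u) = wt u.
Proof. by apply: perm_big; rewrite perm_rev. Qed.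

Lemma rp_alt n a b : rp (alt_word (n + n) a b) = (r a * r b) ^+ n.
Proof.
elim: n => [|n IHn]; first by rewrite big_nil.
by rewrite addSn addnS !altS !big_cons IHn expgS mulgA.
Qed.

Lemma rp_alt_sym n a b : (r a * r b) ^+ n = 1 ->
  rp (alt_word n a b) = rp (alt_word n b a).
Proof.
rewrite -rp_alt alt_double big_cat rp_rev => /divg1_eq. exact.
Qed.

Lemma len_rp u : (len (rp u) <= wt u)%N.
Proof.
elim/last_ind: u => [|u a IHu]; first by rewrite !big_nil len1.
rewrite rp_rcons wt_rcons; apply: leq_trans (lenM _ _) _.
by rewrite leq_add2r.
Qed.

Lemma additive_cat s t : additive (s ++ t) -> additive s /\ additive t.
Proof.
rewrite /additive !big_cat /=; have := lenM (rp s) (rp t).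
have := len_rp s; have := len_rp t.
by move: (len _) (len _) (len _) => p q k; lia.
Qed.

Lemma len_asc_fold w a : ascending (S a) w ->
  len (w * r a) = (len w + len (r a))%N.
Proof. by move=> /asc_len; apply. Qed.

Lemma len_desc_fold w a : descending (S a) w ->
  (len (w * r a) + len (r a))%N = len w.
Proof. by move=> /desc_len; apply. Qed.

Lemma additive_rcons u a : additive u -> ascending (S a) (rp u) ->
  additive (rcons u a).
Proof.
by rewrite /additive rp_rcons wt_rcons => <- /len_asc_fold.
Qed.

Lemma additive_desc u a : additive (rcons u a) -> descending (S a) (rp (rcons u
  a)).
Proof.
move=> ua; have [/len_asc_fold|//] := adm (rcons u a) a.
have := len_rp u; move: ua (r0 a); rewrite /additive rp_rcons rK wt_rcons => ->.
by move: (len _) (len _) => p q; lia.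
Qed.

Lemma desc_asc u a : descending (S a) (rp u) -> ascending (S a) (rp (rcons u
  a)).
Proof.
move=> ud; have [//|/len_desc_fold] := adm (rcons u a) a.
have := len_desc_fold ud; have := r0 a; rewrite rp_rcons rK.
by move: (len _) (len _) (len _) => p q k; lia.
Qed.

Lemma len_rcons_desc u a :
  descending (S a) (rp u) -> (len (rp (rcons u a)) < len (rp u))%N.
Proof.
move/len_desc_fold; rewrite rp_rcons; have := r0 a.
by move: (len _) (len _) (len _) => p q k; lia.
Qed.

Lemma adm_desc u a k : S a k -> (len (rp u * cox_gen m k) < len (rp u))%N ->
  descending (S a) (rp u).
Proof.
move=> ak uk; have [/(_ k ak) ku|//] := adm u a.
by have := ltn_trans ku uk; rewrite ltnn.
Qed.

Lemma rp_parabolic (B : set A) u : all (mem B) u ->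
  parabolic m (\bigcup_(a in B) S a) (rp u).
Proof.
elim: u => [|a u IHu] /=; first by rewrite big_nil => _; exact: parabolic1.
move=> /andP[/set_mem aB /IHu uB]; rewrite big_cons; apply: parabolicM => //.
by apply: (sub_parabolic _ (@rS a)); exact: bigcup_sup.
Qed.

(** A nontrivial product has a descent at some generator, and admissibility extends it to a whole
    block. *)
Lemma fold_desc_ex u : rp u <> 1 -> exists a, descending (S a) (rp u).
Proof.
have /parabolic_desc H : parabolic m (\bigcup_(a in setT) S a) (rp u).
  by apply: rp_parabolic; apply/allP => a _; apply/mem_set.
by move=> /H[k [a _ ak] uk]; exists a; exact: adm_desc uk.
Qed.

Lemma additive_ex u : exists2 v, additive v & rp v = rp u.
Proof.
have [n] := ubnP (len (rp u)); elim: n u => // n IHn u un.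
have [u1|/eqP/fold_desc_ex[a ua]] := eqVneq (rp u) 1.
  by exists [::]; rewrite /additive !big_nil ?len1 ?u1.
have [|v va vE] := IHn (rcons u a).
  by have := len_rcons_desc ua; move: un; move: (len _) (len _) => p q; lia.
exists (rcons v a); last by rewrite rp_rcons vE rp_rcons rK.
by apply: additive_rcons => //; rewrite vE; exact: desc_asc.
Qed.

(** With no descent in [S b], a nontrivial element has one in [S a]. Removing [r a] makes the
    element ascend along [S a], so the roles of [a] and [b] are exchanged. *)
Lemma peel u a b : parabolic m (S a `|` S b) (rp u) -> ascending (S b) (rp u) ->
  exists2 p, additive (rev (alt_word p a b)) & rp (rev (alt_word p a b)) = rp u.
Proof.
have [n] := ubnP (len (rp u)); elim: n u a b => // n IHn u a b un uP uasc.
have [u1|/eqP u1] := eqVneq (rp u) 1.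
  by exists 0; rewrite /additive !big_nil ?len1 ?u1.
have ua : descending (S a) (rp u).
  have [k [ka|kb] uk] := parabolic_desc uP u1; first exact: adm_desc ka uk.
  by have := ltn_trans (uasc k kb) uk; rewrite ltnn.
have [|||p pa pE] := IHn (rcons u a) b a.
- by have := len_rcons_desc ua; move: un; move: (len _) (len _) => p q; lia.
- rewrite setUC rp_rcons; apply: parabolicM => //.
  by apply: (sub_parabolic _ (@rS a)); exact: subsetUl.
- exact: desc_asc.
exists p.+1; rewrite altS rev_cons; last by rewrite rp_rcons pE rp_rcons rK.
by apply: additive_rcons => //; rewrite pE; exact: desc_asc.
Qed.

Lemma peel_desc u a b : parabolic m (S a `|` S b) (rp u) -> descending (S a) (rp
  u) ->
  exists p, additive (rev (alt_word p.+1 a b)) /\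
            rp (rev (alt_word p.+1 a b)) = rp u.
Proof.
move=> uP ua; have [||p pa pE] := @peel (rcons u a) b a.
- rewrite setUC rp_rcons; apply: parabolicM => //.
  by apply: (sub_parabolic _ (@rS a)); exact: subsetUl.
- exact: desc_asc.
exists p; rewrite altS rev_cons; split; last by rewrite rp_rcons pE rp_rcons rK.
by apply: additive_rcons => //; rewrite pE; exact: desc_asc.
Qed.

Lemma wt_alt_le p q a b : (p <= q)%N -> (wt (alt_word p a b) <= wt (alt_word q a
  b))%N.
Proof. by move=> /subnKC <-; rewrite alt_cat big_cat leq_addr. Qed.

(** Dropping the first letter of the longer word aligns the two. Hence equal weights force equal
    numbers of letters, although [r a] and [r b] may differ in length. *)
Lemma wt_alt_lt p q a b : (p < q)%N -> (wt (alt_word p a b) < wt (alt_word q b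
  a))%N.
Proof.
case: q => // q; rewrite ltnS altS big_cons => pq.
by apply: (leq_ltn_trans (wt_alt_le a b pq)); rewrite -[ltnLHS]add0n ltn_add2r.
Qed.

(** Peeling from either side gives two alternating words of equal weight, hence with the same number
    [p.+1] of letters. Their equality gives [(r a * r b)^(p+1) = 1], and additivity excludes smaller
    exponents. *)
Lemma dihedral u a b : parabolic m (S a `|` S b) (rp u) ->
  descending (S a) (rp u) -> descending (S b) (rp u) ->
  exists p, [/\ fold_type a b = Some p.+1,
    additive (rev (alt_word p.+1 a b)), additive (rev (alt_word p.+1 b a)),
    rp (rev (alt_word p.+1 a b)) = rp u & rp (rev (alt_word p.+1 b a)) = rp u].
Proof.
move=> uP ua ub; have [p [pa pE]] := peel_desc uP ua.
rewrite setUC in uP; have [q [qa qE]] := peel_desc uP ub.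
have [pq] : p.+1 = q.+1.
  move: (pa) (qa); rewrite /additive pE qE !wt_rev => -> E.
  case: (ltngtP p.+1 q.+1) => // [/(wt_alt_lt a b)|/(wt_alt_lt b a)];
    by rewrite E ltnn.
rewrite -{}pq in qa qE.
exists p; split=> //; apply: gorder_some => //.
  have E : rp (alt_word p.+1 a b) = rp (alt_word p.+1 b a).
    by apply: invg_inj; rewrite -!rp_rev pE qE.
  by rewrite -rp_alt alt_double big_cat rp_rev E /= mulgV.
move=> k /andP[k0 kp] kE; have pk := rp_alt_sym kE.
(* This suffix is additive, but the braid relation of length [k] makes its first [k] letters equal
   to a word ending in [a], which cancels against the last letter. *)
have : additive (rev (alt_word k.+1 a b)).
  by move: pa; rewrite -(subnKC kp) alt_cat rev_cat => /additive_cat[_].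
rewrite /additive wt_rev altS rev_cons rp_rcons rp_rev -pk -rp_rev.
case: k k0 {kp kE pk} => // k _; rewrite [in LHS]altS rev_cons rp_rcons rK.
have := len_rp (rev (alt_word k b a)); rewrite wt_rev.
have := wt_alt_lt b a (ltnW (ltnSn k.+1)); rewrite altS big_cons.
by move: (len (rp _)) (len (r a)) (wt _) (wt _) => i j x y; lia.
Qed.

(** Strip [r a] or [r b] from the right while one of them descends. The stripped letters form [t],
    and what remains ascends along both blocks. *)
Lemma fold_coset u a b : exists v t, [/\ rp u = rp v * rp t, additive v,
  ascending (S a `|` S b) (rp v) & parabolic m (S a `|` S b) (rp t)].
Proof.
have [n] := ubnP (len (rp u)); elim: n u => // n IHn u un.
have H c : S c `<=` S a `|` S b -> descending (S c) (rp u) ->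
   exists v t, [/\ rp u = rp v * rp t, additive v,
     ascending (S a `|` S b) (rp v) & parabolic m (S a `|` S b) (rp t)].
  move=> cab uc; have [|v [t [E va vab tP]]] := IHn (rcons u c).
    by have := len_rcons_desc uc; move: un; move: (len _) (len _) => p q; lia.
  exists v, (rcons t c); split=> //; rewrite rp_rcons ?mulgA -?E ?rp_rcons ?rK
    //.
  by apply: parabolicM => //; apply: (sub_parabolic _ (@rS c)).
have [ua|/H] := adm u a; last by apply; exact: subsetUl.
have [ub|/H] := adm u b; last by apply; exact: subsetUr.
have [v va vE] := additive_ex u.
exists v, [::]; rewrite vE big_nil mulg1; split=> //; last exact: parabolic1.
by move=> k [/ua|/ub].
Qed.

Theorem additive_cong u v : additive u -> additive v -> rp u = rp v ->
  pres_cong (artin_rel fold_type) u v.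
Proof.
have [n] := ubnP (len (rp u)); elim: n u v => // n IHn u v un.
case/lastP: u un => [|u a] un.
  move=> _; case: v => [|a v]; first by move=> *; exact: pres_refl.
  rewrite big_nil /additive => + E; rewrite -E len1 big_cons.
  by have := r0 a; case: (len _).
case/lastP: v => [|v b].
  move=> + _; rewrite big_nil /additive wt_rcons => + E; rewrite E len1.
  by have := r0 a; case: (len _) => // k; rewrite addnS.
move=> ua vb uv.
have ud := additive_desc ua; have vd := additive_desc vb; rewrite -uv in vd.
have [x [t [E xa xasc tP]]] := fold_coset (rcons u a) a b.
have xlen y := asc_len xasc (v := y).
have td c : S c `<=` S a `|` S b -> descending (S c) (rp (rcons u a)) ->
   descending (S c) (rp t).
  move=> cab + k kc => /(_ k kc); rewrite E -mulgA !xlen ?ltn_add2l //.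
  by apply: parabolicM => //; apply: parabolic_gen; exact: cab.
have [|||p [pab aa ab Ea Eb]] := @dihedral t a b => //.
- by apply: td ud; exact: subsetUl.
- by apply: td vd; exact: subsetUr.
have xadd s : additive s -> rp s = rp t -> additive (x ++ s).
  by rewrite /additive !big_cat /= => <- ->; rewrite xlen // xa.
(* Both words end in [c]; without it they are additive words of one shorter element, to which the
   induction hypothesis applies. *)
have step s c d : additive (rcons s c) -> rp (rcons s c) = rp (rcons u a) ->
  rp (rev (alt_word p.+1 c d)) = rp t -> additive (rev (alt_word p.+1 c d)) ->
  pres_cong (artin_rel fold_type) (rcons s c) (x ++ rev (alt_word p.+1 c d)).
  move=> sc sE cE ca; have := xadd _ ca cE.
  rewrite altS rev_cons -rcons_cat => xca.
  apply: artin_cong_rcons; apply: IHn.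
  - have := sc; rewrite /additive wt_rcons => sc'.
    have := len_rp s; have := r0 c; move: un; rewrite -sE sc'.
    by move: (len _) (len _) => i j; lia.
  - by move: sc; rewrite -cats1 => /additive_cat[].
  - by move: xca; rewrite -cats1 => /additive_cat[].
  apply: (@mulIg _ (r c)); rewrite -!rp_rcons sE E rcons_cat -rev_cons -altS.
  by rewrite big_cat /= cE.
(* Pass from [rcons u a] to [x] followed by the alternating word ending in [a], switch to the one
   ending in [b] by a single braid relation, and return to [rcons v b]. *)
apply: pres_trans (step u a b _ _ _ _) _ => //.
apply: pres_trans (pres_sym (step v b a _ _ _ _)) => //.
apply: artin_cong_cat; first exact: pres_refl.
exact: artin_cong_rev_alt.
Qed.

(** * Comparison with the Coxeter group of the folded type *)

Local Notation cp u := (\prod_(a <- u) cox_gen fold_type a).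

(** Let [a] act on [W] by left multiplication by [r a]. The braid relations hold because the entries
    of [fold_type] are the orders of the products [r a * r b]. *)
Lemma fold_hom u v : cp u = cp v -> rp u = rp v.
Proof.
have actE s x : foldr (fun a x => r a * x) x s = rp s * x.
  by elim: s => [|a s IHs] /=; rewrite ?big_nil ?mul1g // big_cons IHs mulgA.
move=> uv; rewrite -[rp u]mulg1 -[rp v]mulg1 -!actE.
have actK a : involutive (fun x => r a * x) by move=> x; rewrite mulgA rr mul1g.
apply: cox_act uv 1 => // a b n /gorder_someP[_ abn].
by apply: foldr_braid => // x; rewrite actE rp_alt abn mul1g.
Qed.

(** If [r a] descended along an additive prefix [u], then [u] would be braid-equivalent to a word
    ending in [a], and [rcons u a] would not be reduced. *)
Lemma reduced_additive u : size u = len (cp u) -> additive u.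
Proof.
elim/last_ind: u => [|u a IHu]; first by rewrite /additive !big_nil => _; exact:
  len1.
move=> red; have [ur _] := reduced_rcons red; have ua := IHu ur.
have [asc|ud] := adm u a; first exact: additive_rcons.
have [t ta tE] := additive_ex (rcons u a).
have : pres_cong (artin_rel fold_type) u (rcons t a).
  apply: additive_cong => //; last by rewrite rp_rcons tE rp_rcons rK.
  by apply: additive_rcons => //; rewrite tE; exact: desc_asc.
move=> ut; have := artin_cong_size ut; have := artin_cong_prod ut.
rewrite pr_rcons => Eu; have := len_le fold_type t; move: red.
rewrite pr_rcons Eu genK !size_rcons.
by move: (len _) => p; lia.
Qed.

Lemma fold_inj u v : rp u = rp v -> cp u = cp v.
Proof.
have [s su ss] := reducedP (cp u); have [t tv ts] := reducedP (cp v).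
rewrite -(fold_hom su) -(fold_hom tv) -su -tv => st.
by apply: artin_cong_prod; apply: additive_cong => //; apply: reduced_additive;
  rewrite ?su ?tv.
Qed.

(** If [r a] ascended, appending [a] to an additive reduced word would keep it additive, hence
    braid-equivalent to a reduced word; so [a] would be no descent in the folded type. *)
Lemma fold_desc u : descending setT (cp u) -> forall a, descending (S a) (rp u).
Proof.
have [s su ss] := reducedP (cp u); rewrite -su -(fold_hom su) => sd a.
have sa : additive s by apply: reduced_additive; rewrite su.
have [asc|//] := adm s a.
have [t tE ts] := reducedP (cp (rcons s a)).
have : pres_cong (artin_rel fold_type) t (rcons s a).
  apply: additive_cong (fold_hom tE); last exact: additive_rcons.
  by apply: reduced_additive; rewrite ts tE.
move/artin_cong_size; rewrite ts size_rcons ss -su => E.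
by have := sd a Logic.I; rewrite -pr_rcons E ltnNge leqnSn.
Qed.

End Folding.

(** * Simple elements *)

Lemma gen_monoidP (G : monoidType) (A : set G) :
  monoid_closed [in generated_monoid A].
Proof.
split; first by apply/mem_set => B [[/set_mem]].
move=> u v /set_mem uA /set_mem vA; apply/mem_set => B BA.
by case: (BA) => -[_ BM] _; apply/set_mem/BM; apply/mem_set; [exact: uA|exact:
  vA].
Qed.

Lemma gen_monoidM (G : monoidType) (A : set G) x y :
  generated_monoid A x -> generated_monoid A y -> generated_monoid A (x * y).
Proof.
by move=> /mem_set xA /mem_set yA; have /set_mem := (gen_monoidP A).2 _ _ xA yA.
Qed.

Section Simple.
Variables (I : choiceType) (m : I -> I -> option nat).
Local Notation W := (coxeter_group m).
Local Notation len w := (cox_length w%g).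
Local Notation pr u := (\prod_(i <- u) cox_gen m i).
Local Notation ar u := (\prod_(i <- u) artin_gen m i).
Implicit Types (w v : W) (s t : seq I).

Lemma artin_prod_eq s t : ar s = ar t <-> pres_cong (artin_rel m) s t.
Proof. by rewrite -!pres_piE; exact: pres_piP. Qed.

Lemma artin_prod_pr s t : ar s = ar t -> pr s = pr t.
Proof. by move/artin_prod_eq/artin_cong_prod. Qed.

Lemma simple_elt_word w :
  exists s, [/\ pr s = w, size s = len w & simple_elt w = ar s].
Proof.
have /andP[/eqP sw /eqP ss] := xchooseP (reduced_ex w).
by exists (xchoose (reduced_ex w)).
Qed.

Hypothesis cm : coxeter_matrix m.

Lemma len_gen1 i : len (cox_gen m i) = 1%N.
Proof.
by have := len_gen (1 : W) i; rewrite mul1g len1 => -[].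
Qed.

Theorem tits s t : size s = len (pr s) -> size t = len (pr t) ->
  pr s = pr t -> pres_cong (artin_rel m) s t.
Proof.
have -> : artin_rel m = artin_rel (fold_type (cox_gen m)).
  by congr artin_rel; apply: funext => i; apply: funext => j; rewrite /fold_type
    gorder_gen.
have wtE u : (\sum_(i <- u) len (cox_gen m i))%N = size u.
  by under eq_bigr do rewrite len_gen1; rewrite sum1_size.
move=> sr tr; apply: (@additive_cong _ _ _ (fun i => [set i])).
- by move=> i; exact: parabolic_gen.
- exact: cox_gen2.
- by move=> i; rewrite len_gen1.
- move=> u i; case: (asc_or_desc (pr u) i) => ui; [left|right];
    by move=> _ ->.
- by rewrite /additive wtE.
- by rewrite /additive wtE.
Qed.

Lemma simple_eltE s : size s = len (pr s) -> simple_elt (pr s) = ar s.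
Proof.
have [t [ts tl ->]] := simple_elt_word (pr s) => ss.
by apply/artin_prod_eq/tits; rewrite ?ts.
Qed.

Lemma simple_eltM w v : len (w * v) = (len w + len v)%N ->
  simple_elt (w * v) = simple_elt w * simple_elt v.
Proof.
have [s [<- ss ->]] := simple_elt_word w; have [t [<- ts ->]] := simple_elt_word
  v.
move=> E; rewrite -!big_cat /= simple_eltE // big_cat /= E size_cat.
by rewrite ss ts.
Qed.

Lemma simple_prod (A : choiceType) (r : A -> W) (u : seq A) : additive r u ->
  simple_elt (\prod_(a <- u) r a) = \prod_(a <- u) simple_elt (r a).
Proof.
elim: u => [|a u IHu] ua.
  by have := @simple_eltE [::]; rewrite !big_nil len1 => ->.
have [_ ua'] := additive_cat (s := [:: a]) ua.
rewrite !big_cons -IHu //; apply: simple_eltM.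
by move: ua ua'; rewrite /additive !big_cons => -> ->.
Qed.

End Simple.

(** * The folding morphism on simple elements *)

Theorem lemma40 (I : choiceType) (m : I -> I -> option nat)
    (J : set I) (P : set (set I))
    (phi : artin_monoid (partition_type m P) -> artin_monoid m) :
  coxeter_matrix m ->
  admissible m J P ->
  monoid_morphism phi ->
  (forall a : P,
    phi (artin_gen (partition_type m P) a) = simple_elt (longest m (val a))) ->
  [/\ phi @` simple_elts (partition_type m P) =
        folded_monoid m P `&` simple_elts m,
      folded_monoid m P `&` simple_elts m = simple_elt @` folded_group m P,
      spherical (partition_type m P) setT <-> spherical m J &
      spherical (partition_type m P) setT ->
        phi (simple_elt (longest (partition_type m P) setT)) =
        simple_elt (longest m J)].
Proof.
move=> cm [[[PJ Ptriv P0] Psph] Padm] [phi1 phiM] phiE.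
pose r (a : P) : coxeter_group m := longest m (val a).
pose S (a : P) : set I := val a.
have SP a : P (S a) by exact: set_valP.
have rS a : parabolic m (S a) (r a) by exact: (longestP (Psph _ (SP a))).1.
have rr a : r a * r a = 1 by exact: longest_sqr (Psph _ (SP a)).
have r0 a : (0 < cox_length (r a))%N.
  have [k ak] := P0 _ (SP a).
  exact: leq_ltn_trans (leq0n _) ((longestP (Psph _ (SP a))).2 k ak).
have rpW u : folded_group m P (\prod_(a <- u) r a).
  elim: u => [|a u IHu]; first by rewrite big_nil; have [/set_mem] := gen_groupP
    (longest m @` P).
  rewrite big_cons; apply: gen_groupM => //.
  by apply: sub_gen_smallest; exists (S a).
(* Words without inverses suffice, since each [r a] is an involution and inverses are reversed
   words. *)
have Wrp : folded_group m P `<=` [set w | exists u, \prod_(a <- u) r a = w].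
  apply: smallest_sub => [|_ [a aP <-]]; last first.
    by exists [:: SigSub (mem_set aP)]; rewrite big_seq1.
  split; first by apply/mem_set; exists [::]; rewrite big_nil.
  move=> _ _ /set_mem[s <-] /set_mem[t <-]; apply/mem_set.
  by exists (s ++ rev t); rewrite big_cat (rp_rev rr).
have adm u a : ascending (S a) (\prod_(b <- u) r b) \/
               descending (S a) (\prod_(b <- u) r b).
  have [ua|ua] := Padm _ _ (rpW u) (SP a); [left|right] => k /ua[_].
    by move=> ->.
  by move=> <-.
have reda := reduced_additive rS rr r0 adm.
have phiS u : phi (simple_elt (\prod_(a <- u) cox_gen (partition_type m P) a)) =
              simple_elt (\prod_(a <- u) r a).
  have [s [su ss ->]] := simple_elt_word (\prod_(a <- u) cox_gen (partition_type
    m P) a).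
  (* The reduced word [s] is additive for the [r a], so its simple element is the product of those
     of its letters. *)
  rewrite -(fold_hom rr su) simple_prod //; last by apply: reda; rewrite ss su.
  elim: s {su ss} => [|a s IHs]; first by rewrite !big_nil.
  by rewrite !big_cons phiM IHs phiE.
have phiW : phi @` simple_elts (partition_type m P) = simple_elt @` folded_group
  m P.
  apply/seteqP; split=> [_ [_ [w _ <-] <-]|_ [w /Wrp[u <-] <-]].
    by have [u <-] := cox_word_ex w; rewrite phiS; exists (\prod_(a <- u) r a).
  rewrite -phiS; exists (simple_elt (\prod_(a <- u) cox_gen (partition_type m P)
    a)) => //.
  by exists (\prod_(a <- u) cox_gen (partition_type m P) a).
have monW : folded_monoid m P `&` simple_elts m = simple_elt @` folded_group m
  P.
  apply/seteqP; split=> [b [bB [w _ wb]]|_ [w wW <-]]; last first.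
    split; last by exists w.
    (* An additive word of [w] factors its simple element into generators of the folded monoid. *)
    have [u uw] := Wrp _ wW; have [v va vu] := additive_ex rS rr r0 adm u.
    rewrite -uw -vu simple_prod //; elim: v {va vu} => [|a v IHv].
      by rewrite big_nil; exact: set_mem (gen_monoidP _).1.
    rewrite big_cons; apply: gen_monoidM => //.
    by apply: sub_gen_smallest; exists (S a).
  exists w => //.
  have [s [sw _ wE]] := simple_elt_word w.
  (* The projection from the monoid to the group sends the folded monoid into the folded group; here
     it is expressed through representing words. *)
  suff H : folded_monoid m P `<=` [set c | exists2 t,
      c = \prod_(i <- t) artin_gen m i & folded_group m P (\prod_(i <- t)
        cox_gen m i)].
    by have [t] := H _ bB; rewrite -wb wE -sw => /artin_prod_pr ->.
  apply: smallest_sub => [|_ [a aP <-]]; last first.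
    have [t [tE _ ->]] := simple_elt_word (longest m a); exists t => //.
    by rewrite tE; apply: sub_gen_smallest; exists a.
  split.
    apply/mem_set; exists [::]; rewrite big_nil //.
    by have [/set_mem] := gen_groupP (longest m @` P).
  move=> _ _ /set_mem[t -> tW] /set_mem[t' -> tW']; apply/mem_set.
  by exists (t ++ t'); rewrite big_cat //; exact: gen_groupM.
have desc_top u : descending setT (\prod_(a <- u) cox_gen (partition_type m P)
  a) ->
    descending J (\prod_(a <- u) r a).
  move=> ud k; rewrite -PJ => -[a aP ak].
  exact: (fold_desc rS rr r0 adm ud (a := SigSub (mem_set aP))).
have rpJ u : parabolic m J (\prod_(a <- u) r a).
  elim: u => [|a u IHu]; first by rewrite big_nil; exact: parabolic1.
  rewrite big_cons; apply: parabolicM => //; apply: (sub_parabolic _ (@rS a)).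
  by rewrite -PJ => k ak; exists (S a).
split=> //; first by rewrite phiW.
  (* The longest element of the folded type descends at every letter, so its image descends along
     all of [J]. This makes [J] spherical and, in the last claim, identifies the image as the
     longest element for [J]. *)
  split=> [/longestP[_]|fJ].
    have [u <-] := cox_word_ex (longest (partition_type m P) setT).
    by move=> /desc_top; exact: desc_spherical.
  (* [g] inverts the map into [parabolic m J] on its image, through a chosen word; elsewhere the
     default word is empty. By injectivity its values exhaust the folded Coxeter group. *)
  pose g w := \prod_(a <- xget [::] [set u | \prod_(a <- u) r a = w])
    cox_gen (partition_type m P) a.
  apply: (@sub_finite_set _ _ (g @` parabolic m J)); last exact: finite_image.
  move=> w _; have [u <-] := cox_word_ex w.
  exists (\prod_(a <- u) r a) => //; apply: (fold_inj rS rr r0 adm).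
  exact: (@xgetI _ [::] [set v | \prod_(a <- v) r a = \prod_(a <- u) r a] u).
move=> /longestP[_]; have [u <-] := cox_word_ex (longest (partition_type m P)
  setT).
by move=> /desc_top ud; rewrite phiS (desc_longest (rpJ u) ud).
Qed.
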